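(* Let $\mathrm{Fl} = \{\mathrm{fl}_0,\dots,\mathrm{fl}_n\}$ be a tuple of functions which round to nearest in an unperfect floating point system with unit roundoff $u$. If $20 n u\leq 1$ and $\mathbf{x},\mathbf{y}\in\mathbb{R}^{n+1}$, then $$\left| \mathrm{fma}_{\mathrm{Fl}}\left(\sum_{k=0}^n x_k y_k\right) - \sum_{k=0}^n x_k y_k\right| \leq (n+1)\frac{\alpha}{2} + \frac{(n+1)u}{1+(n+1)u}\left(\frac{(n+1)\alpha}{2}+\sum_{k=0}^n |x_k y_k|\right).$$ If, additionally, $u\sum_{k=0}^n|x_ky_k|\ge\alpha$, then $$\left| \mathrm{fma}_{\mathrm{Fl}}\left(\sum_{k=0}^n x_k y_k\right) - \sum_{k=0}^n x_k y_k\right| \leq \frac{(n+1)u}{1+(n+1)u}\sum_{k=0}^n |x_k y_k|.$$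
   Context: Let $\beta \ge 2$ be an integer (the base) and $\mu \ge 1$ an integer. The unit roundoff is $u := 1/(2\beta^{\mu})$. For $e\in\mathbb{Z}$ let $\mathcal{E}_e := \{\beta^e(\beta^\mu + r) : r = 0,1,\dots,(\beta-1)\beta^\mu - 1\}$. Let $e_\alpha < -\mu$ be an integer. The MPFR system associated to $\beta,\mu,e_\alpha$ is $\mathcal{M} := \{0\}\cup\bigcup_{e\ge e_\alpha} (\mathcal{E}_e \cup -\mathcal{E}_e)$. With $\mathcal{S}_{e_\alpha} := \{\beta^{e_\alpha} r : r = 1,\dots,\beta^\mu-1\}$, the IEEE system is $\mathcal{I} := \mathcal{M}\cup \mathcal{S}_{e_\alpha}\cup -\mathcal{S}_{e_\alpha}$. An unperfect system is an IEEE system or an MPFR system. The number $\alpha$ is $\beta^{e_\alpha}$ for the IEEE system and $\beta^{e_\alpha+\mu}$ for the MPFR system. A function $\mathrm{fl}:\mathbb{R}\to\mathbb{R}$ rounds to nearest in a system $\mathcal{F}$ if for all $z\in\mathbb{R}$ one has $\mathrm{fl}(z)\in\mathcal{F}$ and $|\mathrm{fl}(z)-z|\le|x-z|$ for all $x\in\mathcal{F}$ (ties may be broken arbitrarily). A tuple rounds to nearest in $\mathcal{F}$ if each of its elements does (the elements may differ). Dot product with fused multiply-add: put $\hat s_0 := \mathrm{fl}_0(x_0y_0)$ and $\hat s_k := \mathrm{fl}_k(\hat s_{k-1}+x_ky_k)$ for $1\le k\le n$. Then $\mathrm{fma}_{\mathrm{Fl}}\left(\sum_{k=0}^n x_ky_k\right)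 := \hat s_n$. *)

(* Defs.v *)
From mathcomp Require Import all_boot all_order all_algebra.
From mathcomp Require Import classical_sets reals.
Set Implicit Arguments.
Unset Strict Implicit.
Unset Printing Implicit Defensive.
Import Order.TTheory GRing.Theory Num.Theory.
Local Open Scope classical_set_scope.
Local Open Scope ring_scope.

Definition unit_roundoff (R : realType) (beta mu : nat) : R :=
  (2 * beta%:R ^+ mu)^-1.

Definition opp_set (R : realType) (A : set R) : set R := [set - x | x in A].

Definition binade (R : realType) (beta mu : nat) (e : int) : set R :=
  [set beta%:R ^ e * (beta ^ mu + r)%N%:R
    | r in [set r : nat | (r < (beta - 1) * beta ^ mu)%N]].

Definition subnormals (R : realType) (beta mu : nat) (ealpha : int) : set R :=
  [set beta%:R ^ ealpha * r%:R | r in [set r : nat | (0 < r < beta ^ mu)%N]].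

Definition mpfr_system (R : realType) (beta mu : nat) (ealpha : int) : set R :=
  [set 0] `|`
  \bigcup_(e in [set e : int | ealpha <= e])
    (binade beta mu e `|` opp_set (binade beta mu e)).

Definition ieee_system (R : realType) (beta mu : nat) (ealpha : int) : set R :=
  mpfr_system beta mu ealpha `|` subnormals beta mu ealpha
    `|` opp_set (subnormals beta mu ealpha).

Inductive unperfect_kind := IEEE | MPFR.

Definition unperfect_system (R : realType) (kind : unperfect_kind)
    (beta mu : nat) (ealpha : int) : set R :=
  match kind with
  | IEEE => ieee_system beta mu ealpha
  | MPFR => mpfr_system beta mu ealpha
  end.

(* The smallest positive element of the system. *)
Definition alpha (R : realType) (kind : unperfect_kind)
    (beta mu : nat) (ealpha : int) : R :=
  match kind with
  | IEEE => beta%:R ^ ealpha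
  | MPFR => beta%:R ^ (ealpha + mu%:Z)
  end.

Definition rounds_to_nearest (R : realType) (F : set R) (fl : R -> R) : Prop :=
  forall z : R, F (fl z) /\ (forall x : R, F x -> `|fl z - z| <= `|x - z|).

(* The k-th partial result; it is meaningful for k <= n only, since
   [inord k] is a junk index beyond that. *)
Fixpoint fma_partial (R : realType) (n : nat) (Fl : 'I_n.+1 -> R -> R)
    (x y : 'rV[R]_n.+1) (k : nat) : R :=
  match k with
  | 0%N => Fl ord0 (x 0 ord0 * y 0 ord0)
  | k'.+1 => Fl (inord k'.+1)
      (fma_partial Fl x y k' + x 0 (inord k'.+1) * y 0 (inord k'.+1))
  end.

Definition fma_dot (R : realType) (n : nat) (Fl : 'I_n.+1 -> R -> R)
    (x y : 'rV[R]_n.+1) : R :=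
  fma_partial Fl x y n.

(* Main.v *)
Require Import Defs.
From mathcomp Require Import all_boot all_order all_algebra.
From mathcomp Require Import classical_sets reals.
From mathcomp Require Import ring lra.
Import Order.TTheory GRing.Theory Num.Theory.
(** Write z_k = s_(k-1) + p_k with p_k = x_k y_k for the k-th number that is
    rounded, d_k = |s_k - z_k| for its rounding error, D for the sum of the d_k,
    T for the sum of the |p_k|, and N = n + 1.  The total error is at most D, so
    it suffices to bound D.  Both inequalities follow from the dichotomy

      D <= N alpha / 2   or   D <= N u (T - D),

    whose second half says D <= N u / (1 + N u) T.  In the first half the first
    inequality is immediate, and the second follows from alpha <= u T because
    N u <= 1.

    To prove the dichotomy, put A = alpha / (2 u).  This is a power of beta in
    both systems (A = beta^(ealpha + mu) or beta^(ealpha + 2 mu)), and from the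
    scale A on the rounding errors are those of a system without underflow:
    |z| <= A beta^(j+1) implies |fl z - z| <= u A beta^j, the case j = 0 being
    the error alpha / 2 ([rounding_error]).  If every |z_k| is below A beta, each
    d_k is at most u A = alpha / 2 and the first half holds.

    Otherwise let M = A beta^(j+1) be the largest such power reached by some
    |z_k|, and m the first index with |z_m| >= M.  Let E = d_0 + .. + d_(m-1).
    All errors are at most u M, but those before step m are at most
    u M / beta <= u M / 2, so E <= m u M / 2 and D <= E + (N - m) u M.
    On the other hand M lies in the system, so d_m <= |z_m| - M, and s_(k-1) lies
    in the system, so d_k <= |p_k|; these give T - D >= M - 2 E
    ([mass_lower_bound]).  Now D <= N u (M - 2 E) reduces to
    (1 + 2 N u) E <= m u M, which holds as soon as N u <= 1/2: reaching M late
    makes E larger, but it saves half of the allowed error in each earlier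
    step. *)

Local Open Scope classical_set_scope.
Local Open Scope ring_scope.

(** * Recursive sums with rounding errors *)

Definition prev {R : realType} (s : nat -> R) (k : nat) : R :=
  if k is i.+1 then s i else 0.

Definition unrounded {R : realType} (s p : nat -> R) (k : nat) : R :=
  prev s k + p k.

Definition step_error {R : realType} (s p : nat -> R) (k : nat) : R :=
  `|s k - unrounded s p k|.

Lemma prev_minus_sum (R : realType) (s p : nat -> R) (m : nat) :
  `|prev s m - \sum_(k < m) p k| <= \sum_(k < m) step_error s p k.
Proof.
elim: m => [|m IHm]; first by rewrite !big_ord0 subr0 normr0.
rewrite !big_ord_recr /=; apply: le_trans (lerD IHm (lexx _)).
apply: le_trans (ler_normD _ _).
rewrite le_eqVlt; apply/orP; left; apply/eqP; congr (`|_|).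
by rewrite /unrounded; ring.
Qed.

Lemma prev_le_sum (R : realType) (s p : nat -> R) (m : nat) :
  `|prev s m| <= \sum_(k < m) `|p k| + \sum_(k < m) step_error s p k.
Proof.
have -> : prev s m = \sum_(k < m) p k + (prev s m - \sum_(k < m) p k).
  by ring.
apply: le_trans (ler_normD _ _) _.
by apply: lerD; [exact: ler_norm_sum | exact: prev_minus_sum].
Qed.

(** After step m each term contributes |p_k| - d_k >= 0, so only the steps up
    to m count.  Among those, |z_m| <= |s_(m-1)| + |p_m| exceeds the sum of the
    |p_k| by at most the earlier errors, which are then subtracted a second
    time; the last error is paid for by the excess of |z_m| over M. *)
Lemma mass_lower_bound (R : realType) (s p : nat -> R) (N m : nat) (M : R) :
  (m < N)%N -> (forall k, step_error s p k <= `|p k|) ->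
  step_error s p m <= `|unrounded s p m| - M ->
  M - 2 * \sum_(k < m) step_error s p k <=
    \sum_(k < N) `|p k| - \sum_(k < N) step_error s p k.
Proof.
move=> mN dp dm; set d := step_error s p in dp dm *.
have tail : \sum_(k < m.+1) (`|p k| - d k) <= \sum_(k < N) (`|p k| - d k).
  rewrite -!(big_mkord xpredT (fun k => `|p k| - d k)).
  rewrite (big_cat_nat (n := m.+1) (p := N)) //=.
  by rewrite lerDl sumr_ge0 // => k _; rewrite subr_ge0.
rewrite -sumrB; apply: le_trans tail.
rewrite sumrB !big_ord_recr /=.
have := prev_le_sum _ s p m; have := ler_normD (prev s m) (p m).
by move: dm; rewrite /unrounded -/d; lra.
Qed.

(** The argument depends on the system only through the powers A b^j and the
    errors below them, so one proof serves both systems once A is chosen. *)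
Lemma total_error_dichotomy (R : realType) (F : set R) (fl : nat -> R -> R)
    (s p : nat -> R) (b A u : R) (N : nat) :
  2 <= b -> 0 < A -> 0 <= u -> N%:R * u <= 2^-1 ->
  (forall k, rounds_to_nearest F (fl k)) ->
  F 0 -> (forall j, F (A * b ^+ j)) -> (forall j, F (- (A * b ^+ j))) ->
  (forall k j z, `|z| <= A * b ^+ j.+1 -> `|fl k z - z| <= u * (A * b ^+ j)) ->
  (forall k, s k = fl k (unrounded s p k)) ->
  let D := \sum_(k < N) step_error s p k in
  D <= N%:R * (u * A) \/ D <= N%:R * u * (\sum_(k < N) `|p k| - D).
Proof.
move=> b2 A0 u0 Nu flF F0 FM FNM err hs D.
pose z := unrounded s p; pose d := step_error s p.
have hd k : d k = `|fl k (z k) - z k| by rewrite /d /step_error -hs.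
have Fs k : F (prev s k).
  by case: k => [//|k] /=; rewrite hs; case: (flF k (z k)).
(* The previous partial sum is a competitor at distance |p k| from z k. *)
have dp k : d k <= `|p k|.
  rewrite hd; have [_ /(_ _ (Fs k))] := flF k (z k).
  move/le_trans; apply.
  by rewrite /z /unrounded opprD addrA subrr add0r normrN.
have dM k j : A * b ^+ j <= `|z k| -> d k <= `|z k| - A * b ^+ j.
  rewrite hd; have [_ near] := flF k (z k).
  case: (ger0P (z k)) => z0 zM.
    by apply: le_trans (near _ (FM j)) _; rewrite ler0_norm; lra.
  by apply: le_trans (near _ (FNM j)) _; rewrite ger0_norm; lra.
have dle k i : `|z k| <= A * b ^+ i.+1 -> d k <= u * (A * b ^+ i).
  by rewrite hd; exact: err.
have b0 : 0 < b by lra.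
have exj : exists j, [forall k : 'I_N, `|z k| < A * b ^+ j.+1].
  have [j hj] : exists j, (\sum_(k < N) `|z k|) / A < j%:R.
    exists (Num.bound ((\sum_(k < N) `|z k|) / A)); apply: archi_boundP.
    by rewrite divr_ge0 ?sumr_ge0 ?ltW.
  exists j; apply/forallP => k.
  have zk : `|z k| <= \sum_(k < N) `|z k|.
    by rewrite (bigD1 k) //= lerDl sumr_ge0.
  apply: le_lt_trans zk _; rewrite mulrC -ltr_pdivrMr //.
  apply: lt_le_trans hj _.
  have: (j%:R : R) <= 2 ^+ j.+1.
    by rewrite -natrX ler_nat ltnW // (leq_trans (ltn_expl (m := 2) j _)) ?leq_exp2l.
  by move/le_trans; apply; apply: lerXn2r; rewrite ?nnegrE //; lra.
(* For the least such exponent i, A b^i is the largest power that some |z k|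
   reaches, unless i = 0, where all errors are at most u A. *)
case: (ex_minnP exj) => -[|j] /forallP hj minj.
  left; apply: (@le_trans _ _ (\sum_(k < N) u * A)).
    apply: ler_sum => k _; have := dle k 0%N.
    by rewrite expr0 mulr1; apply; exact: ltW (hj k).
  by rewrite sumr_const card_ord -[leLHS]mulr_natl.
right; pose M := A * b ^+ j.+1.
have exm : exists m, (m < N)%N && (M <= `|z m|).
  have : ~~ [forall k : 'I_N, `|z k| < M].
    by apply/negP => /minj; rewrite ltnn.
  rewrite negb_forall => /existsP [m]; rewrite -leNgt => Mm.
  by exists m; rewrite ltn_ord.
(* [m] is the first step that reaches [M]. *)
case: (ex_minnP exm) => m /andP[mN Mm] minm.
have Dm : \sum_(k < m) d k <= m%:R * (u * M / 2).
  apply: (@le_trans _ _ (\sum_(k < m) u * M / 2)); last first.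
    by rewrite sumr_const card_ord -[leLHS]mulr_natl.
  apply: ler_sum => k _.
  have zk : `|z k| < M.
    rewrite ltNge; apply/negP => Mk; have := minm k.
    by rewrite Mk (ltn_trans (ltn_ord k) mN) leqNgt ltn_ord => /(_ isT).
  apply: le_trans (dle _ _ (ltW zk)) _.
  have Aj : 0 <= u * (A * b ^+ j) by rewrite !mulr_ge0 ?exprn_ge0 // ltW.
  (* The bound u M / b of the binade below is at most u M / 2. *)
  have -> : u * M / 2 = u * (A * b ^+ j) * (b / 2) by rewrite /M exprS; ring.
  by rewrite ler_peMr //; lra.
have DN : D <= \sum_(k < m) d k + (N%:R - m%:R) * (u * M).
  rewrite /D -(big_mkord xpredT d) (big_cat_nat (n := m) (p := N)) //=;
    last exact: ltnW.
  rewrite big_mkord lerD2l -natrB; last exact: ltnW.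
  rewrite mulr_natl -sumr_const_nat big_nat_cond [leRHS]big_nat_cond.
  apply: ler_sum => k /andP[/andP[_ kN] _].
  by apply: dle; exact: ltW (hj (Ordinal kN)).
have TD := mass_lower_bound _ s p N m M mN dp (dM _ _ Mm).
apply: (@le_trans _ _ (N%:R * u * (M - 2 * \sum_(k < m) d k))); last first.
  by apply: ler_wpM2l TD; rewrite mulr_ge0.
(* It remains to see E + (N - m) u M <= N u (M - 2 E), where E <= m u M / 2. *)
set E := \sum_(k < m) d k in Dm DN TD *.
have E0 : 0 <= E by apply: sumr_ge0 => k _; exact: normr_ge0.
have : N%:R * u * E <= 2^-1 * E by exact: ler_wpM2r.
by move: DN Dm; lra.
Qed.

(** * Rounding errors in an unperfect system *)

Lemma nearest_integer (R : realType) (t : R) (B : nat) :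
  0 <= t <= B%:R -> exists2 r : nat, (r <= B)%N & `|r%:R - t| <= 2^-1.
Proof.
move=> /andP[t0 tB].
have /truncn_itv /andP[rt tr] : 0 <= t + 2^-1 by lra.
exists (Num.trunc (t + 2^-1)).
  rewrite -ltnS -(ltr_nat R); apply: le_lt_trans rt _.
  by rewrite -[B.+1%:R]natr1; lra.
by rewrite ler_norml; move: tr; rewrite -[in ltRHS]natr1; lra.
Qed.

Lemma unperfect_systemN (R : realType) kind beta mu ealpha (f : R) :
  unperfect_system kind beta mu ealpha f ->
  unperfect_system kind beta mu ealpha (- f).
Proof.
have MN (g : R) : mpfr_system beta mu ealpha g -> mpfr_system beta mu ealpha (- g).
  case=> [->|[e he [ge|[h hh <-]]]].
  - by left; rewrite oppr0.
  - by right; exists e => //; right; exists g.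
  - by right; exists e => //; left; rewrite opprK.
case: kind => /=; last exact: MN.
case=> [[/MN fM|fS]|[g gS <-]].
- by left; left.
- by right; exists f.
- by left; right; rewrite opprK.
Qed.

Lemma unperfect_system0 (R : realType) kind beta mu ealpha :
  unperfect_system kind beta mu ealpha (0 : R).
Proof. by case: kind; [left; left; left | left]. Qed.

Lemma mpfr_sub_unperfect (R : realType) kind beta mu ealpha (f : R) :
  mpfr_system beta mu ealpha f -> unperfect_system kind beta mu ealpha f.
Proof. by case: kind => // fM; left; left. Qed.

(** Number of digits separating beta^ealpha from alpha.  The MPFR system has no
    subnormals, but the multiples of beta^(ealpha + mu) form a full grid around
    0 there, as those of beta^ealpha do in the IEEE system. *)
Definition min_scale (kind : unperfect_kind) (mu : nat) : nat :=
  if kind is IEEE then 0 else mu.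

(** As long as the integer significand has too few digits, multiply it by beta
    and lower the exponent; this ends in a binade, or in the IEEE system possibly
    with 0 or a subnormal at the exponent ealpha.  In the MPFR system the assumption on
    r beta^j guarantees that a binade is reached before ealpha. *)
Lemma grid_in_system (R : realType) kind (beta mu : nat) (ealpha : int)
    (j r : nat) :
  (2 <= beta)%N -> (r <= beta ^ mu.+1)%N ->
  (kind = IEEE \/ (beta ^ mu <= r * beta ^ j)%N) ->
  unperfect_system kind beta mu ealpha
    ((beta%:R : R) ^ (ealpha + j%:Z) * r%:R).
Proof.
move=> b2; have b0 : (0 < beta)%N by exact: ltn_trans b2.
have bR : (beta%:R : R) != 0 by rewrite pnatr_eq0 -lt0n.
have bS e : (beta%:R : R) ^ e * beta%:R = beta%:R ^ (e + 1).
  by rewrite expfzDr // expr1z.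
have inM e r' : ealpha <= e -> (beta ^ mu <= r' < beta ^ mu.+1)%N ->
    unperfect_system kind beta mu ealpha ((beta%:R : R) ^ e * r'%:R).
  move=> he /andP[lor hir]; apply: mpfr_sub_unperfect; right; exists e => //.
  left; exists (r' - beta ^ mu)%N; last by rewrite subnKC.
  rewrite /= mulnBl mul1n -expnS ltn_sub2r //.
  exact: leq_ltn_trans lor hir.
have inM' e r' : ealpha <= e -> (beta ^ mu <= r' <= beta ^ mu.+1)%N ->
    unperfect_system kind beta mu ealpha ((beta%:R : R) ^ e * r'%:R).
  move=> he /andP[lor]; rewrite leq_eqVlt => /predU1P[->|hir]; last first.
    by apply: inM; rewrite ?lor.
  rewrite expnS natrM mulrA bS; apply: inM.
    by apply: le_trans he _; rewrite lerDl.
  by rewrite leqnn ltn_exp2l /=.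
elim: j r => [|j IHj] r rle hk;
  (case: (leqP (beta ^ mu) r) => hr; first by apply: inM'; rewrite ?hr ?lerDl).
- case: hk => [kI|]; last by rewrite expn0 muln1 leqNgt hr.
  rewrite kI addr0; case: r hr {rle} => [|r] hr.
    by rewrite mulr0; exact: unperfect_system0.
  by left; right; exists r.+1.
- have -> : (beta%:R : R) ^ (ealpha + j.+1%:Z) * r%:R =
            beta%:R ^ (ealpha + j%:Z) * (beta * r)%N%:R.
    by rewrite natrM mulrA bS -addrA [j%:Z + 1]addrC -intS.
  apply: IHj; first by rewrite expnS leq_pmul2l // ltnW.
  by case: hk => [->|]; [left | right; rewrite mulnAC -expnS mulnC].
Qed.

(** The multiples r q with r <= beta^(mu+1) all lie in the system, so some
    element is within half a grid step of |z|.  The exponent of q starts at that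
    of alpha, which is why underflow is not a separate case. *)
Lemma rounding_error (R : realType) kind (beta mu : nat) (ealpha : int)
    (fl : R -> R) (j : nat) (z : R) :
  (2 <= beta)%N ->
  rounds_to_nearest (unperfect_system kind beta mu ealpha) fl ->
  let q : R := beta%:R ^ (ealpha + (min_scale kind mu + j)%N%:Z) in
  `|z| <= q * beta%:R ^+ mu.+1 -> `|fl z - z| <= q / 2.
Proof.
move=> b2 hfl q zle; have b0 : (0 < beta)%N by exact: ltn_trans b2.
have q0 : 0 < q by rewrite exprz_gt0 // ltr0n.
have [r rle hr] : exists2 r : nat, (r <= beta ^ mu.+1)%N &
    `|r%:R - `|z| / q| <= 2^-1.
  apply: nearest_integer; apply/andP; split.
    by rewrite divr_ge0 // ltW.
  by rewrite ler_pdivrMr // natrX mulrC.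
have Fr : unperfect_system kind beta mu ealpha (q * r%:R).
  case: r rle {hr} => [|r] rle; first by rewrite mulr0; exact: unperfect_system0.
  apply: grid_in_system => //; case: kind @q zle q0 hfl; [by left | move=> *; right].
  by rewrite /= expnD mulnCA leq_pmulr // muln_gt0 expn_gt0 b0.
have near : `|q * r%:R - `|z| | <= q / 2.
  have -> : q * r%:R - `|z| = q * (r%:R - `|z| / q) by field; exact: lt0r_neq0.
  by rewrite normrM gtr0_norm // ler_wpM2l // ltW.
have [_ best] := hfl z.
case: (ger0P z) near => _ near; first exact: le_trans (best _ Fr) near.
apply: le_trans (best _ (unperfect_systemN _ _ _ _ _ _ Fr)) _.
by move: near; rewrite opprK -[X in _ -> X <= _]normrN opprD !opprK.
Qed.

(** * The dot product with fused multiply-add *)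

Theorem corollary9 (R : realType) (beta mu : nat) (ealpha : int)
    (kind : unperfect_kind) (n : nat) (Fl : 'I_n.+1 -> R -> R)
    (x y : 'rV[R]_n.+1)
    (hbeta : (2 <= beta)%N) (hmu : (1 <= mu)%N) (hea : ealpha < - mu%:Z)
    (hFl : forall k : 'I_n.+1,
       rounds_to_nearest (unperfect_system kind beta mu ealpha) (Fl k))
    (hn : 20 * n%:R * unit_roundoff R beta mu <= 1) :
  let u := unit_roundoff R beta mu in
  let a := alpha R kind beta mu ealpha in
  let N : R := n.+1%:R in
  let S := \sum_(k < n.+1) x 0 k * y 0 k in
  let T := \sum_(k < n.+1) `|x 0 k * y 0 k| in
  `|fma_dot Fl x y - S|
     <= N * (a / 2) + N * u / (1 + N * u) * (N * a / 2 + T)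
  /\
  (a <= u * T ->
   `|fma_dot Fl x y - S| <= N * u / (1 + N * u) * T).
Proof.
move=> u a N S T.
have b2 : (2 : R) <= beta%:R by rewrite ler_nat.
have b0 : (0 : R) < beta%:R by lra.
have u0 : 0 < u by rewrite invr_gt0 mulr_gt0 ?exprn_gt0.
have a_eq : a = beta%:R ^ (ealpha + (min_scale kind mu)%:Z).
  by rewrite /a; case: (kind) => //=; rewrite addr0.
have a0 : 0 < a by rewrite a_eq exprz_gt0.
have N1 : 1 <= N by rewrite /N ler1n.
have Nu : N * u <= 2^-1.
  (* For n = 0 the hypothesis on n u says nothing, but u <= 1/4. *)
  case: (posnP n) => [n0|n1].
    have bmu : (1 : R) <= beta%:R ^+ mu by rewrite exprn_ege1 //; lra.
    rewrite /N n0 mul1r /u /unit_roundoff lef_pV2 ?posrE; lra.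
  have n1R : (1 : R) <= n%:R by rewrite ler1n.
  have : u <= n%:R * u by rewrite ler_peMl // ltW.
  have -> : N * u = n%:R * u + u by rewrite /N -[n.+1%:R]natr1; ring.
  have : 20 * (n%:R * u) <= 1 by rewrite mulrA.
  lra.
pose A := a * beta%:R ^+ mu.
have uA : u * A = a / 2.
  rewrite /u /unit_roundoff /A; field.
  by rewrite lt0r_neq0 // exprn_gt0.
have scale j : a * beta%:R ^+ j =
    beta%:R ^ (ealpha + (min_scale kind mu + j)%N%:Z).
  by rewrite a_eq exprnP -expfzDr ?lt0r_neq0 // -addrA.
have FA j : unperfect_system kind beta mu ealpha (A * beta%:R ^+ j).
  rewrite /A -mulrA -exprD addnC exprD mulrA scale -natrX.
  apply: grid_in_system => //; first by rewrite leq_exp2l.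
  by right; rewrite leq_pmulr // expn_gt0 ltnW.
pose s := fma_partial Fl x y.
pose p k := x 0 (inord k) * y 0 (inord k).
pose fl k := Fl (inord k).
have hs k : s k = fl k (unrounded s p k).
  case: k => [|k] //; rewrite /unrounded /= add0r /fl /p.
  by rewrite (_ : inord 0 = ord0) //; apply: val_inj; rewrite /= inordK.
have pE k (i : 'I_n.+1) : k = i -> p k = x 0 i * y 0 i.
  by move=> ->; rewrite /p inord_val.
have TE : \sum_(k < n.+1) `|p k| = T.
  by apply: eq_bigr => k _; rewrite (pE _ k).
have SE : \sum_(k < n.+1) p k = S.
  by apply: eq_bigr => k _; rewrite (pE _ k).
have := prev_minus_sum _ s p n.+1; rewrite SE /= -/(fma_dot Fl x y).
have A0 : 0 < A by rewrite mulr_gt0 ?exprn_gt0.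
have := total_error_dichotomy _ (unperfect_system kind beta mu ealpha) fl s p
  beta%:R A u n.+1 b2 A0 (ltW u0) Nu (fun k => hFl _)
  (unperfect_system0 _ _ _ _ _) FA
  (fun j => unperfect_systemN _ _ _ _ _ _ (FA j)).
case=> // [k j z zle||].
  rewrite mulrA uA mulrAC scale.
  apply: (rounding_error _ kind beta mu ealpha (fl k) j z hbeta (hFl _)).
  by rewrite -scale exprS mulrA (le_trans zle) // /A exprS !mulrA; lra.
all: rewrite ?TE ?uA -/N; set D := \sum_(k < n.+1) _ => hD eD.
all: set e := `|_| in eD *.
all: set phi := N * u / (1 + N * u).
all: have T0 : 0 <= T by apply: sumr_ge0.
all: have q0 : 0 < N * u by rewrite mulr_gt0 //; lra.
all: have phi0 : 0 <= phi by rewrite divr_ge0 //; lra.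
all: have Na0 : 0 <= N * a by rewrite mulr_ge0 //; lra.
- split.
    have : 0 <= phi * (N * a / 2 + T) by rewrite mulr_ge0 //; lra.
    by lra.
  move=> auT; have NaT : N * a <= N * (u * T) by rewrite ler_wpM2l //; lra.
  have : N * u / 2 * T <= phi * T.
    rewrite ler_wpM2r // ler_wpM2l ?(ltW q0) // lef_pV2 ?posrE; lra.
  by lra.
- have main : e <= phi * T.
    rewrite /phi mulrAC ler_pdivlMr; last by lra.
    have : e * (1 + N * u) <= D * (1 + N * u) by rewrite ler_wpM2r //; lra.
    by lra.
  split=> //; apply: le_trans main _.
  have : 0 <= phi * (N * a / 2) by rewrite mulr_ge0 //; lra.
  by lra.
Qed.
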